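(* Assume that $p\in(1,2)\cup(2,\infty)$, and define $(q,r,s)$ by: $q=\frac2p$, $r=p$ if $p\in(1,2)$; $q=\frac p2$, $r=2$ if $p\in(2,4)$; $q=\frac p{p-2}$, $r=p-2$ if $p\ge4$; and $s=\max\{2,p\}$. Then there exists a positive constant $\mathsf C$, depending only on $p$, such that for any integer $d\ge1$ and any $u\in\mathrm L^p(\mathbb S^d)$ (with $u\in\mathrm L^2(\mathbb S^d)$ if $p<2$), we have \[ \frac1{p-2}\Big[\|u\|_{\mathrm L^p(\mathbb S^d)}^2-\|u\|_{\mathrm L^2(\mathbb S^d)}^2\Big]\ge\mathsf C\,\|u\|_{\mathrm L^s(\mathbb S^d)}^{2(1-r)}\,\big\||u|^r-\bar u^r\big\|_{\mathrm L^q(\mathbb S^d)}^2\quad\text{where}\quad\bar u=\|u\|_{\mathrm L^r(\mathbb S^d)}. \]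
   Context: Functions are real valued; $\mathbb S^d$ is the unit sphere in $\mathbb R^{d+1}$ with the normalized (probability) measure $\mu$ induced by the Euclidean measure, and all norms are with respect to $\mu$. The right-hand side is read as $0$ if $u=0$. *)

(* Defs.v *)
From HB Require Import structures.
From mathcomp Require Import all_boot all_order all_algebra.
From mathcomp Require Import all_classical all_reals all_analysis.
From mathcomp Require Import measurable_realfun.
Set Implicit Arguments.
Unset Strict Implicit.
Unset Printing Implicit Defensive.
Import Order.TTheory GRing.Theory Num.Theory.
Import numFieldNormedType.Exports.
Local Open Scope classical_set_scope.
Local Open Scope ring_scope.

Section tuple_cons.
Context {R : realType}.

Definition tuple_cons n (z : R * n.-tuple R) : n.+1.-tuple R :=
  [the n.+1.-tuple R of z.1 :: z.2].

Lemma measurable_tuple_cons n : measurable_fun [set: R * n.-tuple R] (@tuple_cons n).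
Proof. exact: measurable_cons. Qed.

Lemma behead_tuple_cons n (z : R * n.-tuple R) :
  [tuple of behead (tuple_cons z)] = z.2.
Proof. exact: val_inj. Qed.

End tuple_cons.

Section lebesgue_succ.
Local Open Scope ereal_scope.
Context {R : realType} (n : nat).
Variable m : {sigma_finite_measure set (n.-tuple R) -> \bar R}.

Definition lebesgue_succ : set (n.+1.-tuple R) -> \bar R :=
  pushforward (@lebesgue_measure R \x m) (@tuple_cons R n).

Let lebesgue_succ0 : lebesgue_succ set0 = 0.
Proof. by rewrite /lebesgue_succ /pushforward preimage_set0 measure0. Qed.

Let lebesgue_succ_ge0 A : 0 <= lebesgue_succ A.
Proof. exact: (measure_ge0 (@lebesgue_measure R \x m)). Qed.

Let mtc (A : set (n.+1.-tuple R)) : measurable A -> measurable (@tuple_cons R n @^-1` A).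
Proof.
by move=> mA; rewrite -[X in measurable X]setTI; exact: measurable_tuple_cons.
Qed.

Let lebesgue_succ_sigma_additive : semi_sigma_additive lebesgue_succ.
Proof.
move=> F mF tF mUF; rewrite /lebesgue_succ /pushforward preimage_bigcup.
apply: (@measure_semi_sigma_additive _ _ _ (@lebesgue_measure R \x m)).
- by move=> k; exact: mtc.
- apply/trivIsetP => /= i j _ _ ij; rewrite -preimage_setI.
  by move/trivIsetP : tF => /(_ _ _ _ _ ij) ->//; rewrite preimage_set0.
- by rewrite -preimage_bigcup; exact: mtc.
Qed.

HB.instance Definition _ := isMeasure.Build _ _ _ lebesgue_succ
  lebesgue_succ0 lebesgue_succ_ge0 lebesgue_succ_sigma_additive.

Definition cons_box (A : set R) (B : set (n.-tuple R)) : set (n.+1.-tuple R) :=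
  [set x | A (thead x) /\ B [tuple of behead x]].

Lemma measurable_consbox A B : measurable A -> measurable B -> measurable (cons_box A B).
Proof.
move=> mA mB; rewrite (_ : cons_box A B = (fun x => tnth x ord0) @^-1` A `&`
   (fun x : n.+1.-tuple R => [tuple of behead x]) @^-1` B)//.
apply: measurableI; rewrite -[X in measurable X]setTI.
  exact: measurable_tnth.
exact: measurable_behead.
Qed.

Lemma lebesgue_succ_box A B : measurable A -> measurable B ->
  lebesgue_succ (cons_box A B) = lebesgue_measure A * m B.
Proof.
move=> mA mB; rewrite -product_measure1E// /lebesgue_succ /pushforward.
congr (product_measure1 _ _ _); apply/seteqP.
by split => -[a t]; rewrite /cons_box /preimage /mkset behead_tuple_cons.
Qed.

Let lebesgue_succ_sigma_finite : sigma_finite setT lebesgue_succ.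
Proof.
have [F UF mF] := sigma_finiteT (@lebesgue_measure R).
have [G UG mG] := sigma_finiteT m.
pose H k := if unpickle k is Some (i, j) then cons_box (F i) (G j) else set0.
exists H.
  apply/seteqP; split => // x _.
  have : (\bigcup_i F i) (thead x) by rewrite -UF.
  have : (\bigcup_i G i) [tuple of behead x] by rewrite -UG.
  move=> [j _ Gj] [i _ Fi]; exists (pickle (i, j)) => //.
  by rewrite /H pickleK.
move=> k; rewrite /H; case: unpickle => [[i j]|]; last by rewrite measure0.
have [mFi Fi] := mF i; have [mGj Gj] := mG j.
split; first exact: measurable_consbox.
by rewrite lebesgue_succ_box// lte_mul_pinfty ?ge0_fin_numE.
Qed.

HB.instance Definition _ :=
  Measure_isSigmaFinite.Build _ _ _ lebesgue_succ lebesgue_succ_sigma_finite.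

End lebesgue_succ.

Section lebesgue_tuple.
Local Open Scope ereal_scope.
Context {R : realType}.

(* Lebesgue measure on R^n, as an iterated product of the one-dimensional one. *)
Fixpoint lebesgue_tuple n : {sigma_finite_measure set (n.-tuple R) -> \bar R} :=
  match n with
  | 0 => [the {sigma_finite_measure set (0.-tuple R) -> \bar R} of dirac [tuple]]
  | n.+1 => [the {sigma_finite_measure set (n.+1.-tuple R) -> \bar R} of
              lebesgue_succ (lebesgue_tuple n)]
  end.

Lemma lebesgue_tuple_box n (A : set R) : measurable A ->
  measurable [set x : n.-tuple R | forall i, A (tnth x i)] /\
  lebesgue_tuple n [set x | forall i, A (tnth x i)] = lebesgue_measure A ^+ n.
Proof.
move=> mA; elim: n => [|n [mIH IH]].
  rewrite (_ : [set x | _] = setT); last by apply/seteqP; split => // x _ [].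
  by split => //; rewrite expe0 /= diracT.
rewrite (_ : [set x : n.+1.-tuple R | _] =
    cons_box A [set x : n.-tuple R | forall i, A (tnth x i)]).
  split; first exact: measurable_consbox.
  rewrite -[LHS]/(lebesgue_succ (lebesgue_tuple n) (cons_box A _)).
  by rewrite lebesgue_succ_box// expeS; congr (_ * _).
apply/seteqP; split => x /=.
  move=> Ax; split => [|i]; first exact: Ax.
  by rewrite (_ : tnth _ i = tnth x (lift ord0 i))// [in RHS](tuple_eta x) tnthS.
move=> [A0 AS] i; case: (unliftP ord0 i) => [j ->|-> //].
by rewrite [x]tuple_eta tnthS.
Qed.

End lebesgue_tuple.

Section euclidean.
Context {R : realType}.

Definition euclidean_norm n (x : n.-tuple R) : R :=
  Num.sqrt (\sum_(i < n) tnth x i ^+ 2).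

Definition unit_ball n : set (n.-tuple R) := [set x | euclidean_norm x <= 1].

Lemma measurable_euclidean_norm n :
  measurable_fun [set: n.-tuple R] (@euclidean_norm n).
Proof.
apply: (@measurableT_comp _ _ _ _ _ _ (@Num.sqrt R) _
  (fun x : n.-tuple R => \sum_(i < n) tnth x i ^+ 2)).
  by apply: continuous_measurable_fun; exact: sqrt_continuous.
apply: measurable_sum => i.
by apply: measurable_funX; exact: measurable_tnth.
Qed.

Lemma measurable_unit_ball n : measurable (@unit_ball n).
Proof.
rewrite (_ : unit_ball (n:=n) = (@euclidean_norm n) @^-1` `]-oo, 1]).
  by rewrite -[X in measurable X]setTI; exact: measurable_euclidean_norm.
by apply/seteqP; split => x /=; rewrite in_itv.
Qed.

Lemma lebesgue_unit_ball_gt0 n : (0 < lebesgue_tuple n (@unit_ball n))%E.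
Proof.
have [m1 m2] := @lebesgue_tuple_box R n `[0, n.+1%:R^-1] (measurable_itv _).
have : (0 < @lebesgue_measure R `[0%R, n.+1%:R^-1%R] ^+ n)%E.
  rewrite lebesgue_measure_itv /= lte_fin invr_gt0 ltr0n /= oppr0 adde0.
  by rewrite -EFin_expe lte_fin exprn_gt0// invr_gt0 ltr0n.
rewrite -m2 => /lt_le_trans; apply; apply: le_measure; rewrite ?inE//; first exact: measurable_unit_ball.
move=> x /= hx; rewrite /unit_ball /= /euclidean_norm -(sqrtr1 R) ler_wsqrtr//.
apply: (@le_trans _ _ (\sum_(i < n) n.+1%:R^-1)).
  apply: ler_sum => i _; have := hx i; rewrite in_itv /= => /andP[h0 h1].
  rewrite expr2 -[leRHS]mulr1 ler_pM// (le_trans h1)// invf_le1 ?ltr0n// ler1n//.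
by rewrite sumr_const card_ord -[leLHS]mulr_natr mulrC ler_pdivrMr ?ltr0n// mul1r ler_nat.
Qed.

Lemma lebesgue_unit_ball_lty n : (lebesgue_tuple n (@unit_ball n) < +oo)%E.
Proof.
have [m1 m2] := @lebesgue_tuple_box R n `[-1, 1] (measurable_itv _).
have : (@lebesgue_measure R `[(-1)%R, 1%R] ^+ n < +oo)%E.
  rewrite lebesgue_measure_itv /= lte_fin gtrN ?ltr01//.
  by rewrite -EFinD -EFin_expe ltry.
rewrite -m2; apply: le_lt_trans; apply: le_measure; rewrite ?inE//; first exact: measurable_unit_ball.
move=> x; rewrite /unit_ball /= /euclidean_norm => hx i.
rewrite in_itv /= -ler_norml -sqrtr_sqr (le_trans _ hx)// ler_wsqrtr//.
by rewrite (bigD1 i)//= lerDl sumr_ge0// => j _; rewrite sqr_ge0.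
Qed.

End euclidean.

Section sphere.
Context (R : realType) (d : nat).

(* The unit sphere S^d of R^(d+1), with the trace of the Borel sigma-algebra. *)
Definition sphere := {x : d.+1.-tuple R | euclidean_norm x == 1}.

Let north : d.+1.-tuple R := [tuple (i == ord0)%:R | i < d.+1].

Let north_norm : euclidean_norm north == 1.
Proof.
rewrite /euclidean_norm big_ord_recl big1 => [|i _].
  by rewrite !tnth_mktuple eqxx expr1n addr0 sqrtr1.
by rewrite tnth_mktuple expr0n.
Qed.

HB.instance Definition _ := Choice.on sphere.
HB.instance Definition _ := isPointed.Build sphere (exist _ north north_norm).

HB.instance Definition _ := Measurable.copy sphere
  (g_sigma_algebra_preimageType (fun x : sphere => \val x)).

(* The radial projection x / |x|; insubd only uses its default at the origin,
   which is Lebesgue-negligible. *)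
Definition radial (x : d.+1.-tuple R) : sphere :=
  insubd (point : sphere) [tuple tnth x i / euclidean_norm x | i < d.+1].

Let euclidean_norm_scale (x : d.+1.-tuple R) : euclidean_norm x != 0 ->
  euclidean_norm [tuple tnth x i / euclidean_norm x | i < d.+1] = 1.
Proof.
move=> x0; rewrite {1}/euclidean_norm.
under eq_bigr do rewrite tnth_mktuple expr_div_n.
have s0 : 0 <= \sum_(i < d.+1) tnth x i ^+ 2 by apply: sumr_ge0 => i _; exact: sqr_ge0.
rewrite -mulr_suml sqr_sqrtr// divff ?sqrtr1//.
by apply: contra x0 => /eqP xe; rewrite /euclidean_norm xe sqrtr0.
Qed.

Let tnth_radial (i : 'I_d.+1) (x : d.+1.-tuple R) : tnth (\val (radial x)) i =
  if euclidean_norm x == 0 then tnth (\val (point : sphere)) i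
  else tnth x i * euclidean_norm x `^ (-1).
Proof.
rewrite val_insubd; case: (eqVneq (euclidean_norm x) 0) => [x0|x0].
  case: ifPn => //; rewrite {1}/euclidean_norm big1 ?sqrtr0 1?eq_sym ?oner_eq0//.
  by move=> j _; rewrite tnth_mktuple x0 invr0 mulr0 expr0n.
rewrite euclidean_norm_scale// eqxx tnth_mktuple powR_inv1//.
by rewrite sqrtr_ge0.
Qed.

Lemma measurable_radial : measurable_fun [set: d.+1.-tuple R] radial.
Proof.
have mvr : measurable_fun [set: d.+1.-tuple R] (fun x => \val (radial x)).
  apply/measurable_fun_tnthP => i.
  rewrite (_ : _ \o _ = fun x => if euclidean_norm x == 0
      then tnth (\val (point : sphere)) i
      else tnth x i * euclidean_norm x `^ (-1)); last first.
    by apply/funext => x; exact: tnth_radial.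
  apply: measurable_fun_ifT => //.
    by apply: measurable_fun_eqr => //; exact: measurable_euclidean_norm.
  apply: measurable_funM; first exact: measurable_tnth.
  apply: (@measurableT_comp _ _ _ _ _ _ (fun a : R => a `^ (-1)) _
    (@euclidean_norm R d.+1)); first exact: measurable_powR.
  exact: measurable_euclidean_norm.
move=> _ _ [B mB <-]; rewrite !setTI.
by rewrite -[X in measurable X]setTI; exact: mvr.
Qed.

Let ball : set (d.+1.-tuple R) := @unit_ball R d.+1.

(* Normalized surface measure: the mass of A is the proportion of the unit ball
   (for Lebesgue measure) filled by the cone over A with apex the origin. *)
Definition sphere_measure (A : set sphere) : \bar R :=
  (lebesgue_tuple d.+1 (ball `&` radial @^-1` A) *
   (fine (lebesgue_tuple d.+1 ball))^-1%:E)%E.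

Let mradial (A : set sphere) : measurable A -> measurable (radial @^-1` A).
Proof.
by move=> mA; rewrite -[X in measurable X]setTI; exact: measurable_radial.
Qed.

Let sphere_measure0 : sphere_measure set0 = 0%E.
Proof. by rewrite /sphere_measure preimage_set0 setI0 measure0 mul0e. Qed.

Let sphere_measure_ge0 A : (0 <= sphere_measure A)%E.
Proof. by rewrite mule_ge0// lee_fin invr_ge0 fine_ge0. Qed.

Let sphere_measure_sigma_additive : semi_sigma_additive sphere_measure.
Proof.
move=> F mF tF mUF; rewrite /sphere_measure preimage_bigcup setI_bigcupr.
rewrite [X in X @ _ --> _](_ : _ = (fun n =>
    (\sum_(0 <= i < n) lebesgue_tuple d.+1 (ball `&` radial @^-1` F i)) *
    (fine (lebesgue_tuple d.+1 ball))^-1%:E)%E); last first.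
  by apply/funext => n; rewrite ge0_sume_distrl.
have mB i : measurable (ball `&` radial @^-1` F i).
  by apply: measurableI; [exact: measurable_unit_ball|exact: mradial].
apply: cvgeZr => //; apply: measure_semi_sigma_additive => //.
- apply/trivIsetP => /= i j _ _ ij; rewrite setIACA -preimage_setI.
  by move/trivIsetP : tF => /(_ _ _ _ _ ij) ->//; rewrite preimage_set0 setI0.
- exact: bigcup_measurable.
Qed.

HB.instance Definition _ := isMeasure.Build _ _ _ sphere_measure
  sphere_measure0 sphere_measure_ge0 sphere_measure_sigma_additive.

Let sphere_measureT : sphere_measure setT = 1%E.
Proof.
rewrite /sphere_measure preimage_setT setIT.
have b0 := @lebesgue_unit_ball_gt0 R d.+1.
have boo := @lebesgue_unit_ball_lty R d.+1.
have bfin : lebesgue_tuple d.+1 ball \is a fin_num by rewrite ge0_fin_numE// ltW.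
by rewrite -[X in (X * _)%E](fineK bfin) -EFinM divff// gt_eqF// fine_gt0// b0.
Qed.

HB.instance Definition _ :=
  Measure_isProbability.Build _ _ _ sphere_measure sphere_measureT.

(* Real-valued L^p norm; fine is harmless whenever the norm is finite. *)
Definition sphere_norm (p : R) (f : sphere -> R) : R :=
  fine 'N[sphere_measure]_p%:E[EFin \o f].

End sphere.

Section exponents.
Context {R : realType} (p : R).

Definition exponent_q : R :=
  if p < 2 then 2 / p else if p < 4 then p / 2 else p / (p - 2).

Definition exponent_r : R := if p < 2 then p else if p < 4 then 2 else p - 2.

Definition exponent_s : R := Num.max 2 p.

End exponents.

(* Main.v *)
Require Import Defs.
From mathcomp Require Import all_boot all_order all_algebra.
From mathcomp Require Import all_classical all_reals all_analysis.
From mathcomp Require Import lra ring measurable_realfun.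
Set Implicit Arguments.
Unset Strict Implicit.
Unset Printing Implicit Defensive.
Import Order.TTheory GRing.Theory Num.Theory.
Local Open Scope ring_scope.

(** The inequality holds on every probability space: the sphere enters only
through the normalization of its measure, which is why the constant does not
depend on d.

Write A and B for the norms of u in L^s and L^r, put g = |u|^r and let m = B^r
be the mean of g.  In each of the three ranges of p one has q = s / r, s >= 2
and r < s <= 2 r, so that 1 < q <= 2.  The deficit in Jensen's inequality for
t^q is then A^s - B^s = int g^q - m^q, and the statement is a stability
estimate for this deficit, of Csiszar-Kullback-Pinsker type
([jensen_powR_stability]):

  K_q G^(1 - 2/q) || g - m ||_q^2 <= G - m^q,   where G = int g^q.

To prove it, integrate a lower bound of the pointwise deficit
y^q - m^q - q m^(q-1) (y - m).  Strong convexity bounds the deficit below by a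
multiple of max(y, m)^(q-2) (y - m)^2 ([powR_strongly_convex]).  Passing from
this weighted L^2 quantity to the L^q norm is usually done with Hoelder's
inequality; here it is done pointwise, with a free scale k > 0
([powR_bregman_lb]).  With w = |y - m| and x = max(y, m), the bound
x^(q-2) w^2 >= k^(2-q) (w^q - k^q x^q) holds when w <= k x because its
right-hand side is nonpositive, and when w > k x because w^(2-q) >= (k x)^(2-q).  After
integration, k is chosen so that the negative term absorbs half of int w^q.

It remains to compare squares with s-th powers: convexity of t^(s/2) gives
A^s - B^s <= (s/2) A^(s-2) (A^2 - B^2) ([powR_sub_le_sqr]), hence
A^2 - B^2 >= C A^(2 (1 - r)) || g - m ||_q^2 ([Lnormr_sqr_stability]).  For
p < 4 the two norms in the statement are exactly A and B; for p >= 4, B is the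
norm in L^(p-2), which dominates the norm in L^2. *)

(** * Tangent inequalities for real powers *)

Section power_inequalities.
Context {R : realType}.
Implicit Types a b c k m q t x y : R.

Lemma gt0_powRD x a b : 0 < x -> x `^ (a + b) = x `^ a * x `^ b.
Proof. by move=> x0; apply: powRD; rewrite (gt_eqF x0) implybT. Qed.

(** Young's inequality for [y * x `^ (a - 1)] with the exponents [a] and
[a / (a - 1)], rearranged; this avoids derivatives and covers [x = 0]. *)
Lemma powR_convex_tangent a x y : 1 <= a -> 0 <= x -> 0 <= y ->
  x `^ a + a * x `^ (a - 1) * (y - x) <= y `^ a.
Proof.
rewrite le_eqVlt => /predU1P[<-|a1] x0 y0.
  by rewrite subrr powRr0 mulr1 mul1r !powRr1// subrKC.
have a0 : 0 < a by apply: lt_trans a1.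
have b0 : 0 < a / (a - 1) by rewrite divr_gt0// subr_gt0.
have a1n0 : a - 1 != 0 by rewrite subr_eq0 gt_eqF.
have := conjugate_powR y0 (powR_ge0 x (a - 1)) a0 b0.
rewrite -powRrM mulrCA divff// mulr1 => /(_ _)/wrap[].
  by field; rewrite a1n0 gt_eqF.
rewrite -(ler_pM2l a0) => h.
have xE : x * x `^ (a - 1) = x `^ a by rewrite mulr_powRB1.
have -> : a * x `^ (a - 1) * (y - x) =
  a * (y * x `^ (a - 1)) - a * x `^ a by rewrite -xE; ring.
rewrite addrCA -lerBrDr opprD opprK (le_trans h)// le_eqVlt; apply/orP; left.
by apply/eqP; field; rewrite a1n0 gt_eqF.
Qed.

(** The convex tangent inequality for the inverse power [t `^ b^-1], taken at
[x `^ b] and [y `^ b] and solved for [y `^ b]. *)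
Lemma powR_concave_tangent b x y : 0 < b <= 1 -> 0 < x -> 0 <= y ->
  y `^ b <= x `^ b + b * x `^ (b - 1) * (y - x).
Proof.
move=> /andP[b0 b1] x0 y0.
have := @powR_convex_tangent b^-1 (x `^ b) (y `^ b).
rewrite invf_ge1// => /(_ b1 (powR_ge0 _ _) (powR_ge0 _ _)).
rewrite -!powRrM divff ?gt_eqF// !powRr1 ?(ltW x0)//.
have -> : b * (b^-1 - 1) = 1 - b by field; rewrite gt_eqF.
move=> h.
have xx : x `^ (b - 1) * x `^ (1 - b) = 1.
  by rewrite -gt0_powRD// addrC subrKA subrr powRr0.
have := ler_wpM2l (mulr_ge0 (ltW b0) (powR_ge0 x (b - 1))) h.
rewrite mulrDr.
have -> : b * x `^ (b - 1) * (b^-1 * x `^ (1 - b) * (y `^ b - x `^ b)) =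
  (b / b) * (x `^ (b - 1) * x `^ (1 - b)) * (y `^ b - x `^ b) by ring.
rewrite xx divff ?gt_eqF// !mul1r; lra.
Qed.

(** The derivative of [t `^ q] increases fast enough: since [q - 1] is at most 1,
[t `^ (q - 1)] is concave and lies below its tangent at the larger point. *)
Lemma powR_diff_lb q x y : 1 < q <= 2 -> 0 <= y <= x ->
  (q - 1) * x `^ (q - 2) * (x - y) <= x `^ (q - 1) - y `^ (q - 1).
Proof.
move=> /andP[q1 q2] /andP[y0 yx].
move: (le_trans y0 yx); rewrite le_eqVlt => /predU1P[x0|x0].
  have -> : y = x by apply/eqP; rewrite eq_le yx -x0 y0.
  by rewrite !subrr mulr0.
have h := @powR_concave_tangent (q - 1) x y _ x0 y0.
have /h : 0 < q - 1 <= 1 by lra.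
by rewrite (_ : q - 1 - 1 = q - 2); [lra|ring].
Qed.

(** Going from [m] to [y] through the midpoint [n], and using a tangent on each
half, bounds the deficit below by half the increment of the derivative between
[m] and [n] times [y - m]; [powR_diff_lb] then estimates that increment. *)
Lemma powR_strongly_convex q m y : 1 < q <= 2 -> 0 <= m -> 0 <= y ->
  q * (q - 1) / 4 * Num.max y m `^ (q - 2) * (y - m) ^+ 2 <=
  y `^ q - m `^ q - q * m `^ (q - 1) * (y - m).
Proof.
move=> /andP[q1 q2] m0 y0.
set n := (y + m) / 2.
have n0 : 0 <= n by rewrite divr_ge0// addr_ge0.
have q1' := ltW q1.
have T1 := powR_convex_tangent q1' m0 n0.
have T2 := powR_convex_tangent q1' n0 y0.
have q0 : 0 < q by lra.
have T : q * (n `^ (q - 1) - m `^ (q - 1)) * (y - m) / 2 <=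
    y `^ q - m `^ q - q * m `^ (q - 1) * (y - m).
  have nm : n - m = (y - m) / 2 by rewrite /n; field.
  have yn : y - n = (y - m) / 2 by rewrite /n; field.
  by move: T1 T2; rewrite nm yn; lra.
apply: le_trans T.
have [ym|my] := leP y m.
  have q12 : 1 < q <= 2 by rewrite q1.
  have nm : 0 <= n <= m by rewrite n0 /n; lra.
  have := powR_diff_lb q12 nm.
  have -> : m - n = (m - y) / 2 by rewrite /n; field.
  move=> D.
  have qm : 0 <= q * (m - y) / 2.
    by rewrite divr_ge0// mulr_ge0 ?subr_ge0// ltW.
  have := ler_wpM2r qm D; lra.
have q12 : 1 < q <= 2 by rewrite q1.
have mn : 0 <= m <= n by rewrite m0 /n; lra.
have := powR_diff_lb q12 mn.
have -> : n - m = (y - m) / 2 by rewrite /n; field.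
move=> D.
have qm : 0 <= q * (y - m) / 2.
  by rewrite divr_ge0// mulr_ge0 ?subr_ge0// ltW.
have n1 : 0 < n by rewrite /n divr_gt0// ltr_wpDr// (le_lt_trans m0).
have ny : y `^ (q - 2) <= n `^ (q - 2).
  rewrite -(opprB 2 q) !powRN lef_pV2 ?posrE ?powR_gt0 ?(le_lt_trans m0 my)//.
  by rewrite ge0_ler_powR ?nnegrE// ?subr_ge0// /n; lra.
have h := ler_wpM2r qm D.
apply: (@le_trans _ _ (q * (q - 1) / 4 * n `^ (q - 2) * (y - m) ^+ 2)); last lra.
rewrite ler_wpM2r ?sqr_ge0// ler_wpM2l// divr_ge0// mulr_ge0// ?subr_ge0; lra.
Qed.

(** The scale [k] separates the points where [|y - m|] is small with respect to
[max y m], at which the left-hand side is nonpositive, from those where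
[max y m `^ (q - 2)] is at least [k `^ (2 - q) * |y - m| `^ (q - 2)].  Keeping
[k] free replaces Hoelder's inequality once the bound is integrated. *)
Lemma powR_bregman_lb q k m y : 1 < q <= 2 -> 0 < k -> 0 <= m -> 0 <= y ->
  q * (q - 1) / 4 * k `^ (2 - q) *
    (`|y - m| `^ q - k `^ q * (y `^ q + m `^ q)) <=
  y `^ q - m `^ q - q * m `^ (q - 1) * (y - m).
Proof.
move=> q12 k0 m0 y0; apply: le_trans (powR_strongly_convex q12 m0 y0).
move/andP: q12 => [q1 q2].
have c0 : 0 <= q * (q - 1) / 4 by rewrite divr_ge0// mulr_ge0// ?subr_ge0; lra.
rewrite -!(mulrA (q * (q - 1) / 4)) ler_wpM2l//.
set x := Num.max y m.
have x0 : 0 <= x by rewrite /x le_max y0.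
have xq : x `^ q <= y `^ q + m `^ q.
  by rewrite /x; case: (leP y m) => _; rewrite ?lerDl ?lerDr powR_ge0.
have [wx|xw] := leP (`|y - m|) (k * x).
  apply: (@le_trans _ _ 0); last by rewrite mulr_ge0 ?powR_ge0 ?sqr_ge0.
  rewrite mulr_ge0_le0 ?powR_ge0// subr_le0.
  apply: (@le_trans _ _ ((k * x) `^ q)).
    by rewrite ge0_ler_powR ?nnegrE ?mulr_ge0// ltW//; lra.
  by rewrite powRM ?(ltW k0)// ler_wpM2l ?powR_ge0.
have {}x0 : 0 < x.
  move: x0; rewrite le_eqVlt => /predU1P[xe|//].
  have [] : y <= 0 /\ m <= 0 by rewrite xe /x !le_max !lexx orbT.
  move=> y0' m0'; have y00 : y = 0 by lra.
  have m00 : m = 0 by lra.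
  by move: xw; rewrite y00 m00 subr0 normr0 -xe mulr0 ltxx.
have w0 : 0 < `|y - m| by rewrite (le_lt_trans _ xw)// mulr_ge0// ltW.
rewrite -real_normK ?num_real//; move: w0 xw; set w := `|y - m| => w0 xw.
have -> : w ^+ 2 = w `^ q * w `^ (2 - q).
  by rewrite -gt0_powRD// subrKC powR_mulrn// ltW.
have kw : (k * x) `^ (2 - q) <= w `^ (2 - q).
  by rewrite ge0_ler_powR ?nnegrE ?subr_ge0// ?ltW// mulr_gt0.
apply: (@le_trans _ _ (k `^ (2 - q) * w `^ q)).
  by rewrite ler_wpM2l ?powR_ge0// lerBlDr lerDl mulr_ge0 ?powR_ge0//
    addr_ge0 ?powR_ge0.
apply: (@le_trans _ _ (x `^ (q - 2) * (w `^ q * (k * x) `^ (2 - q)))).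
  rewrite powRM ?(ltW k0) ?(ltW x0)//.
  have xx : x `^ (q - 2) * x `^ (2 - q) = 1.
    by rewrite -gt0_powRD// addrC subrKA subrr powRr0.
  have -> : x `^ (q - 2) * (w `^ q * (k `^ (2 - q) * x `^ (2 - q))) =
    x `^ (q - 2) * x `^ (2 - q) * (k `^ (2 - q) * w `^ q) by ring.
  by rewrite xx mul1r.
by rewrite !ler_wpM2l ?powR_ge0.
Qed.

End power_inequalities.

(** * Stability in Jensen's inequality for powers *)

(** The value that results from the scale chosen in [jensen_powR_stability]; the
factor 8 is the 4 of [powR_strongly_convex] times 2, for the half of the integral
of [`|g x - m| `^ q] lost there. *)
Definition stability_constant (R : realType) (q : R) : R :=
  q * (q - 1) / 8 * 4 `^ (1 - 2 / q).

Lemma optimal_scaleE (R : realType) (q N G : R) : 0 < q -> 0 < N -> 0 < G ->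
  q * (q - 1) / 4 * (N / (4 * G)) `^ q^-1 `^ (2 - q) * (N / 2) =
  stability_constant q * G `^ (1 - 2 / q) * N `^ (2 / q).
Proof.
move=> q0 N0 G0.
rewrite -powRrM (_ : q^-1 * (2 - q) = 2 / q - 1); last by field; rewrite gt_eqF.
have G4 : 0 <= 4 * G by rewrite mulr_ge0// ltW.
have N4 : 0 <= (4 * G)^-1 by rewrite invr_ge0.
rewrite (powRM (2 / q - 1) (ltW N0) N4).
rewrite -(powR_inv1 G4) -powRrM.
rewrite (_ : -1 * (2 / q - 1) = 1 - 2 / q); last by ring.
rewrite (powRM _ _ (ltW G0))//.
have NE : N `^ (2 / q) = N `^ (2 / q - 1) * N.
  by rewrite -{3}(powRr1 (ltW N0)) -gt0_powRD// subrK.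
rewrite NE /stability_constant.
generalize (N `^ (2 / q - 1)) (4 `^ (1 - 2 / q)) (G `^ (1 - 2 / q)) => n f h.
by field.
Qed.

Section probability_space.
Context d {T : measurableType d} {R : realType} (P : probability T R).
Implicit Types (f g : T -> R) (a b m q r s : R).

Lemma measurable_norm_powR f a :
  measurable_fun setT f -> measurable_fun setT (fun x => `|f x| `^ a).
Proof.
by move=> mf; apply: (measurableT_comp (measurable_powR _)) => //;
  exact: measurableT_comp.
Qed.

(** The total mass is finite and [t `^ a <= 1 + t `^ b] for [t >= 0]. *)
Lemma integrable_powRW f a b : measurable_fun setT f -> 0 <= a <= b ->
  P.-integrable setT (EFin \o (fun x => `|f x| `^ b)) ->
  P.-integrable setT (EFin \o (fun x => `|f x| `^ a)).
Proof.
move=> mf /andP[a0 ab] ib.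
have i1 : P.-integrable setT (EFin \o (cst 1 : T -> R)).
  exact: finite_measure_integrable_cst.
apply: le_integrable (integrableD _ i1 ib) => //.
  by apply/measurable_EFinP; exact: measurable_norm_powR.
move=> x _ /=; rewrite lee_fin (ger0_norm (powR_ge0 _ _)) [leRHS]ger0_norm
  ?addr_ge0 ?powR_ge0//.
have [f1|/ltW f1] := leP 1 `|f x|.
  by apply: ler_wpDl => //; exact: ler_powR.
apply: ler_wpDr; first exact: powR_ge0.
have := @ge0_ler_powR _ a a0 `|f x| 1; rewrite powR1.
by apply; rewrite ?nnegrE.
Qed.

Lemma Rintegral_cstT (c : R) : \int[P]_x c = c.
Proof.
rewrite Rintegral_cst//.
by rewrite (_ : fine _ = 1) ?mulr1// -[RHS]/(fine 1%E) -(probability_setT P).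
Qed.

Lemma integrable_tangent g a : P.-integrable setT (EFin \o g) ->
  forall c m, P.-integrable setT (EFin \o (fun x => c + a * (g x - m))) /\
  \int[P]_x (c + a * (g x - m)) = c + a * (\int[P]_x g x - m).
Proof.
move=> ig c m.
have icst k : P.-integrable setT (EFin \o (cst k : T -> R)).
  exact: finite_measure_integrable_cst.
have igm : P.-integrable setT (EFin \o (fun x => g x - m)).
  exact: (integrableB _ ig (icst m)).
have iagm : P.-integrable setT (EFin \o (fun x => a * (g x - m))).
  exact: (integrableZl measurableT a igm).
split; first exact: (integrableD _ (icst c) iagm).
rewrite (@RintegralD _ _ _ P setT (fun=> c))//; last exact: icst.
rewrite (@RintegralZl _ _ _ P setT (fun x => g x - m))//.
rewrite (@RintegralB _ _ _ P setT g (fun=> m))//; last exact: icst.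
by rewrite !Rintegral_cstT.
Qed.

(** The tangent at the mean has integral zero beyond its constant term. *)
Lemma jensen_powR g a : 1 <= a -> (forall x, 0 <= g x) ->
  P.-integrable setT (EFin \o g) ->
  P.-integrable setT (EFin \o (fun x => g x `^ a)) ->
  (\int[P]_x g x) `^ a <= \int[P]_x (g x `^ a).
Proof.
move=> a1 g0 ig iga; set m := \int[P]_x g x.
have m0 : 0 <= m by apply: Rintegral_ge0.
have [it itE] := integrable_tangent (a * m `^ (a - 1)) ig (m `^ a) m.
have := @le_Rintegral _ _ _ P setT _ _ measurableT it iga _.
rewrite itE -/m subrr mulr0 addr0; apply => x _.
exact: powR_convex_tangent.
Qed.

(** Integrating [powR_bregman_lb] with [m] the mean of [g] removes the linear term
and leaves [G - m `^ q >= c (N - k `^ q (G + m `^ q))], where [m `^ q <= G] by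
Jensen's inequality.  The choice [k `^ q = N / (4 G)] makes the subtracted term
at most [N / 2] and gives the right homogeneity in [N] and [G]; here [G] and [N]
are the integrals of [g x `^ q] and [`|g x - m| `^ q]. *)
Lemma jensen_powR_stability g q m : m = \int[P]_x g x -> 1 < q <= 2 ->
  measurable_fun setT g -> (forall x, 0 <= g x) ->
  P.-integrable setT (EFin \o (fun x => g x `^ q)) ->
  stability_constant q * (\int[P]_x (g x `^ q)) `^ (1 - 2 / q) *
    (\int[P]_x (`|g x - m| `^ q)) `^ (2 / q) <=
  \int[P]_x (g x `^ q) - m `^ q.
Proof.
move=> mE q12 mg g0 igq; have /andP[q1 q2] := q12.
have q0 : 0 < q by apply: lt_trans q1.
have gE b : (fun x => `|g x| `^ b) = (fun x => g x `^ b).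
  by apply/funext => x; rewrite ger0_norm.
have ig : P.-integrable setT (EFin \o g).
  rewrite (_ : g = (fun x => `|g x| `^ 1)); last first.
    by apply/funext => x; rewrite powRr1// ger0_norm.
  by apply: (@integrable_powRW _ _ q); rewrite ?gE//; lra.
set G := \int[P]_x (g x `^ q); set N := \int[P]_x (`|g x - m| `^ q).
have m0 : 0 <= m by rewrite mE; apply: Rintegral_ge0.
have N0 : 0 <= N by apply: Rintegral_ge0 => x _; exact: powR_ge0.
have mG : m `^ q <= G by rewrite mE; apply: jensen_powR => //; exact: ltW.
have mq0 := powR_ge0 m q.
have imq : P.-integrable setT (EFin \o (cst (m `^ q) : T -> R)).
  exact: finite_measure_integrable_cst.
have iB : P.-integrable setT (EFin \o (fun x => g x `^ q + m `^ q)).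
  exact: (integrableD _ igq imq).
have BE : \int[P]_x (g x `^ q + m `^ q) = G + m `^ q.
  by rewrite (@RintegralD _ _ _ P setT (fun x => g x `^ q) (fun=> m `^ q))//
    Rintegral_cstT.
have w_le x : `|g x - m| `^ q <= g x `^ q + m `^ q.
  have gx0 := g0 x; have [h|h] := ler0P (g x - m).
    apply: ler_wpDl; first exact: powR_ge0.
    by apply: (ge0_ler_powR (ltW q0)); rewrite ?nnegrE; lra.
  apply: ler_wpDr; first exact: powR_ge0.
  by apply: (ge0_ler_powR (ltW q0)); rewrite ?nnegrE; lra.
have iN : P.-integrable setT (EFin \o (fun x => `|g x - m| `^ q)).
  apply: le_integrable iB => //.
    apply/measurable_EFinP; apply: measurable_norm_powR.
    exact: measurable_funB.
  move=> x _ /=; rewrite lee_fin (ger0_norm (powR_ge0 _ _)) [leRHS]ger0_norm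
  ?addr_ge0 ?powR_ge0//.
(* Besides bounding N, this forces G > 0 as soon as N > 0. *)
have NG : N <= G + m `^ q by rewrite -BE; exact: le_Rintegral.
move: N0; rewrite le_eqVlt => /predU1P[<-|N0].
  by rewrite (@powR0 _ (2 / q)) ?mulr0 ?subr_ge0// gt_eqF// divr_gt0.
have G0 : 0 < G by lra.
have NG0 : 0 < N / (4 * G) by apply: divr_gt0 => //; apply: mulr_gt0.
pose k := (N / (4 * G)) `^ q^-1.
have k0 : 0 < k by exact: powR_gt0.
have kq : k `^ q = N / (4 * G).
  by rewrite /k -powRrM (mulVf (lt0r_neq0 q0)) (powRr1 (ltW NG0)).
set c := q * (q - 1) / 4 * k `^ (2 - q).
have c0 : 0 <= c by rewrite mulr_ge0 ?powR_ge0// divr_ge0// mulr_ge0//; lra.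
have main : c * (N - k `^ q * (G + m `^ q)) <= G - m `^ q.
  have ikB : P.-integrable setT (EFin \o (fun x =>
      k `^ q * (g x `^ q + m `^ q))).
    exact: (integrableZl measurableT (k `^ q) iB).
  have iD : P.-integrable setT (EFin \o (fun x => `|g x - m| `^ q -
      k `^ q * (g x `^ q + m `^ q))) by exact: (integrableB _ iN ikB).
  have iL : P.-integrable setT (EFin \o (fun x => c * (`|g x - m| `^ q -
      k `^ q * (g x `^ q + m `^ q)))).
    exact: (integrableZl measurableT c iD).
  have [it itE] := integrable_tangent (q * m `^ (q - 1)) ig (m `^ q) m.
  have iR : P.-integrable setT (EFin \o (fun x => g x `^ q -
      (m `^ q + q * m `^ (q - 1) * (g x - m)))).
    exact: (integrableB _ igq it).
  have := @le_Rintegral _ _ _ P setT _ _ measurableT iL iR _.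
  rewrite RintegralZl// RintegralB// RintegralZl// BE RintegralB//.
  rewrite itE -mE -/G -/N subrr mulr0 addr0; apply => x _.
  by rewrite opprD addrA; exact: powR_bregman_lb.
apply: le_trans main.
apply: (@le_trans _ _ (c * (N / 2))); last first.
  have GG : (G + m `^ q) / (4 * G) <= 2^-1.
    by rewrite ler_pdivrMr ?mulr_gt0//; lra.
  rewrite ler_wpM2l// kq mulrAC -mulrA.
  have := ler_wpM2l (ltW N0) GG; lra.
by rewrite /c /k (optimal_scaleE q0 N0 G0).
Qed.

End probability_space.

(** * From moments to norms *)

Lemma stability_constant_gt0 (R : realType) (q : R) :
  1 < q -> 0 < stability_constant q.
Proof.
move=> q1; rewrite /stability_constant mulr_gt0 ?powR_gt0// divr_gt0//.
by rewrite mulr_gt0 ?subr_gt0//; lra.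
Qed.

(** Tangent at [A ^+ 2] of the convex function [t `^ (s / 2)]. *)
Lemma powR_sub_le_sqr (R : realType) (s A B : R) :
  2 <= s -> 0 <= A -> 0 <= B ->
  A `^ s - B `^ s <= s / 2 * A `^ (s - 2) * (A ^+ 2 - B ^+ 2).
Proof.
move=> s2 A0 B0.
have sqE (X t : R) : 0 <= X -> (X ^+ 2) `^ t = X `^ (2 * t).
  by move=> X0; rewrite -powR_mulrn// -powRrM.
have s1 : 1 <= s / 2 by lra.
have := powR_convex_tangent s1 (sqr_ge0 A) (sqr_ge0 B).
rewrite !sqE//.
have -> : 2 * (s / 2) = s by field.
have -> : 2 * (s / 2 - 1) = s - 2 by field.
lra.
Qed.

Section norms.
Context d {T : measurableType d} {R : realType} (P : probability T R).
Implicit Types (f : T -> R) (a b m q r s : R).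

(** For the measure of the sphere this is [sphere_norm], by conversion. *)
Definition Lnormr a f : R := fine 'N[P]_a%:E[EFin \o f].

Lemma LnormrE a f : Lnormr a f = (\int[P]_x (`|f x| `^ a)) `^ a^-1.
Proof. by rewrite /Lnormr unlock fine_poweR. Qed.

Lemma Lnormr_ge0 a f : 0 <= Lnormr a f.
Proof. by rewrite LnormrE powR_ge0. Qed.

Lemma moment_ge0 a f : 0 <= \int[P]_x (`|f x| `^ a).
Proof. by apply: Rintegral_ge0 => x _; exact: powR_ge0. Qed.

Lemma powR_Lnormr a f : a != 0 -> Lnormr a f `^ a = \int[P]_x (`|f x| `^ a).
Proof. by move=> a0; rewrite LnormrE -powRrM mulVf// powRr1// moment_ge0. Qed.

Lemma Lnormr_le a b f : 0 < a <= b -> measurable_fun setT f ->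
  P.-integrable setT (EFin \o (fun x => `|f x| `^ b)) ->
  Lnormr a f <= Lnormr b f.
Proof.
move=> /andP[a0 ab] mf ib.
have b0 : 0 < b by apply: lt_le_trans ab.
have ba1 : 1 <= b / a by rewrite ler_pdivlMr// mul1r.
have ia : P.-integrable setT (EFin \o (fun x => `|f x| `^ a)).
  by apply: integrable_powRW ib; rewrite // (ltW a0).
have fE : (fun x => `|f x| `^ b) = (fun x => (`|f x| `^ a) `^ (b / a)).
  by apply/funext => x; rewrite -powRrM mulrC divfK// gt_eqF.
have := jensen_powR ba1 (fun x => powR_ge0 `|f x| a) ia.
rewrite -fE => /(_ ib); rewrite -!powR_Lnormr ?gt_eqF//.
rewrite -powRrM mulrC divfK ?gt_eqF//.
move=> h; have bi : 0 <= b^-1 by rewrite invr_ge0 ltW.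
have := ge0_ler_powR bi (powR_ge0 _ _) (powR_ge0 _ _) h.
by rewrite -!powRrM divff ?gt_eqF// !powRr1 ?Lnormr_ge0.
Qed.

(** [jensen_powR_stability] for [|f| `^ r] with exponent [s / r]. *)
Lemma Lnormr_powR_stability r s f : 0 < r -> r < s <= 2 * r ->
  measurable_fun setT f ->
  P.-integrable setT (EFin \o (fun x => `|f x| `^ s)) ->
  stability_constant (s / r) * Lnormr s f `^ (s - 2 * r) *
    Lnormr (s / r) (fun x => `|f x| `^ r - Lnormr r f `^ r) ^+ 2 <=
  Lnormr s f `^ s - Lnormr r f `^ s.
Proof.
move=> r0 /andP[rs s2r] mf iS.
have s0 : 0 < s by apply: lt_trans rs.
have rn0 : r != 0 by rewrite gt_eqF.
have sn0 : s != 0 by rewrite gt_eqF.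
set q := s / r.
have q0 : 0 < q by apply: divr_gt0.
have q12 : 1 < q <= 2 by rewrite ltr_pdivlMr// ler_pdivrMr// mul1r rs.
have fE : (fun x => `|f x| `^ s) = (fun x => (`|f x| `^ r) `^ q).
  by apply/funext => x; rewrite -powRrM mulrC divfK.
have := jensen_powR_stability (powR_Lnormr f rn0) q12
  (measurable_norm_powR r mf) (fun x => powR_ge0 _ _).
rewrite -fE => /(_ iS).
rewrite -(powR_Lnormr f sn0) -!powRrM [r * q]mulrC divfK//.
rewrite (_ : s * (1 - 2 / q) = s - 2 * r); last first.
  by rewrite /q; field; rewrite rn0.
by rewrite (LnormrE q) -(@powR_mulrn _ _ 2) ?powR_ge0// -powRrM [q^-1 * _]mulrC.
Qed.

(** When the norm in L^s vanishes, so does its power on the left, because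
[r != 1]; otherwise [Lnormr_powR_stability] and [powR_sub_le_sqr] combine after
multiplication by [2 / s * A `^ (2 - s)], which turns the exponent [s - 2 * r] into
[2 * (1 - r)]; here [A] is the norm in L^s. *)
Lemma Lnormr_sqr_stability r s f : 0 < r -> r != 1 -> 2 <= s ->
  r < s <= 2 * r -> measurable_fun setT f ->
  P.-integrable setT (EFin \o (fun x => `|f x| `^ s)) ->
  2 / s * stability_constant (s / r) * Lnormr s f `^ (2 * (1 - r)) *
    Lnormr (s / r) (fun x => `|f x| `^ r - Lnormr r f `^ r) ^+ 2 <=
  Lnormr s f ^+ 2 - Lnormr r f ^+ 2.
Proof.
move=> r0 r1 s2 rs mf iS.
have s0 : 0 < s by lra.
have AB : Lnormr r f <= Lnormr s f.
  by apply: Lnormr_le => //; rewrite r0/=; lra.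
have := Lnormr_powR_stability r0 rs mf iS.
have := powR_sub_le_sqr s2 (Lnormr_ge0 s f) (Lnormr_ge0 r f).
have := Lnormr_ge0 r f; have := Lnormr_ge0 s f.
set Q := Lnormr (s / r) _; set K := stability_constant _.
move: (Lnormr s f) (Lnormr r f) AB Q K => A B AB Q K A0 B0.
move: A0; rewrite le_eqVlt => /predU1P[A0 _ _|A0].
  rewrite -A0 powR0; last by rewrite mulf_neq0// subr_eq0 eq_sym.
  by rewrite mulr0 mul0r subr_ge0 A0 ler_sqr ?nnegrE// -A0.
move=> h1 /le_trans => /(_ _ h1) h.
have w0 := mulr_ge0 (divr_ge0 (ler0n R 2) (ltW s0)) (powR_ge0 A (2 - s)).
have := ler_wpM2l w0 h.
have e1 : A `^ (2 - s) * A `^ (s - 2) = 1.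
  by rewrite -gt0_powRD// addrC subrKA subrr powRr0.
have e2 : A `^ (2 - s) * A `^ (s - 2 * r) = A `^ (2 * (1 - r)).
  by rewrite -gt0_powRD//; congr (_ `^ _); ring.
have -> : 2 / s * A `^ (2 - s) * (K * A `^ (s - 2 * r) * Q ^+ 2) =
  2 / s * K * (A `^ (2 - s) * A `^ (s - 2 * r)) * Q ^+ 2 by ring.
have -> : 2 / s * A `^ (2 - s) * (s / 2 * A `^ (s - 2) * (A ^+ 2 - B ^+ 2)) =
  (A `^ (2 - s) * A `^ (s - 2)) * (A ^+ 2 - B ^+ 2).
  by field; rewrite gt_eqF.
by rewrite e1 e2 mul1r.
Qed.

End norms.

(** * The three ranges of p *)

Theorem proposition1 (R : realType) (p : R) (p_gt1 : 1 < p) (p_neq2 : p != 2) :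
  let q := exponent_q p in
  let r := exponent_r p in
  let s := exponent_s p in
  exists2 C : R, 0 < C &
    forall (d : nat) (u : sphere R d -> R), (1 <= d)%N ->
      u \in Lfun (sphere_measure (R := R) (d := d)) p%:E ->
      (p < 2 -> u \in Lfun (sphere_measure (R := R) (d := d)) 2%:E) ->
      let ubar := sphere_norm r u in
      (* if u = 0 a.e., then 0 `^ (2 * (1 - r)) = 0 since r != 1, and the
         right-hand side is 0 *)
      (p - 2)^-1 * (sphere_norm p u ^+ 2 - sphere_norm 2 u ^+ 2) >=
        C * sphere_norm s u `^ (2 * (1 - r)) *
          sphere_norm q (fun x => `|u x| `^ r - ubar `^ r) ^+ 2.
Proof.
move=> q r s.
have [r0 r1 s2 rs qE] : [/\ 0 < r, r != 1, 2 <= s, r < s <= 2 * r & q = s / r].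
  rewrite /q /r /s /exponent_q /exponent_r /exponent_s.
  have [p2|p2] := ltP p 2.
    by split=> //; lra.
  have [p4|p4] := ltP p 4.
    by split=> //; lra.
  by split=> //; lra.
exists (`|p - 2|^-1 * (2 / s * stability_constant (s / r))).
  rewrite mulr_gt0 ?invr_gt0 ?normr_gt0 ?subr_eq0// mulr_gt0 ?divr_gt0//.
    by lra.
  by apply: stability_constant_gt0; rewrite ltr_pdivlMr// mul1r; case/andP: rs.
move=> d u _ up u2; cbv zeta.
have us : u \in Lfun (sphere_measure (R := R) (d := d)) s%:E.
  rewrite /s /exponent_s; have [p2|p2] := ltP p 2.
    exact: u2.
  exact: up.
have mu : measurable_fun setT u.
  by move: up; rewrite inE => /andP[/[!inE]].
have is_ := Lfun_integrable (le_trans (ler1n _ 2) s2) us.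
have := Lnormr_sqr_stability r0 r1 s2 rs mu is_.
rewrite -qE -![Lnormr _ _ _]/(sphere_norm _ _) => stab.
set D := sphere_norm s u ^+ 2 - sphere_norm r u ^+ 2 in stab.
apply: (@le_trans _ _ (`|p - 2|^-1 * D)).
  by rewrite -!(mulrA `|p - 2|^-1) ler_wpM2l// invr_ge0.
rewrite /D /s /r /exponent_s /exponent_r.
have [p2|p2] := ltP p 2.
  by rewrite ler0_norm ?subr_le0 ?(ltW p2)// invrN mulNr -mulrN opprB.
rewrite ger0_norm ?subr_ge0//; have [//|p4] := ltP p 4.
(* Here r = p - 2 >= 2, and replacing the L^r norm by the L^2 norm only
   increases the left-hand difference of squares. *)
rewrite ler_wpM2l ?invr_ge0 ?subr_ge0// lerB// ler_sqr ?nnegrE ?Lnormr_ge0//.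
apply: Lnormr_le => //; first by lra.
apply: (integrable_powRW mu _ (Lfun_integrable (ltW p_gt1) up)); lra.
Qed.
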